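(* For $t\in[1,\infty)$ let $$F(t)=\begin{bmatrix}\frac1{t^2}&\frac1{t^2}&0&0&\sqrt{\frac{t^4-1}{t^4}}&-\sqrt{\frac{t^4-1}{t^4}}\\[2pt]0&0&\sqrt{\frac{t^4-1}{t^4}}&-\sqrt{\frac{t^4-1}{t^4}}&\frac1{t^2}&\frac1{t^2}\\[2pt]\sqrt{\frac{t^4-1}{t^4}}&-\sqrt{\frac{t^4-1}{t^4}}&\frac1{t^2}&\frac1{t^2}&0&0\end{bmatrix}.$$ Among the frames with synthesis matrices $F(t)$, $t\in[1,\infty)$, there are uncountably many pairwise inequivalent biangular $(6,3)$-frames whose squared frame angles are transcendental numbers.
   Context: An $(n,m)$-frame for $\mathbb R^m$ is a family $\{f_j\}_{j=1}^n$ of $n$ unit vectors in $\mathbb R^m$ that is tight, i.e. its synthesis matrix $F=[f_1\,\cdots\,f_n]$ satisfies $FF^*=aI_m$ for some $a>0$. Its frame angles are the elements of the frame angle set $\{|\langle f_j,f_{j'}\rangle| : j\neq j'\}$, and it is biangular if this set has exactly two elements. Two biangular $(n,m)$-frames are inequivalent if they have different frame angle sets. *)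

(* Defs.v *)
From mathcomp Require Import all_boot all_order all_algebra.
From mathcomp Require Import boolp classical_sets cardinality set_interval reals.

Set Implicit Arguments.
Unset Strict Implicit.
Unset Printing Implicit Defensive.

Import Order.TTheory GRing.Theory Num.Theory.

Local Open Scope classical_set_scope.
Local Open Scope card_scope.
Local Open Scope ring_scope.

Definition inner (R : realType) (m : nat) (u v : 'cV[R]_m) : R :=
  \sum_(i < m) u i 0 * v i 0.

(* MathComp-Analysis equips matrices with the max norm, so `|v| would not be
   the Euclidean norm. *)
Definition euclidean_norm (R : realType) (m : nat) (v : 'cV[R]_m) : R :=
  Num.sqrt (inner v v).

Definition synthesis (R : realType) (m n : nat) (f : 'I_n -> 'cV[R]_m) :
    'M[R]_(m, n) :=
  \matrix_(i < m, j < n) f j i 0.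

Definition columns (R : realType) (m n : nat) (F : 'M[R]_(m, n)) :
    'I_n -> 'cV[R]_m :=
  fun j => col j F.

Lemma synthesis_columns (R : realType) (m n : nat) (F : 'M[R]_(m, n)) :
  synthesis (columns F) = F.
Proof. by apply/matrixP => i j; rewrite !mxE. Qed.

Lemma columns_synthesis (R : realType) (m n : nat) (f : 'I_n -> 'cV[R]_m) :
  columns (synthesis f) = f.
Proof. by apply/funext => j; apply/matrixP => i k; rewrite !mxE ord1. Qed.

Definition is_frame (R : realType) (n m : nat) (f : 'I_n -> 'cV[R]_m) : Prop :=
  (forall j : 'I_n, euclidean_norm (f j) = 1) /\
  (exists2 a : R, 0 < a & synthesis f *m (synthesis f)^T = a%:M).

Definition frame_angle_set (R : realType) (n m : nat) (f : 'I_n -> 'cV[R]_m) :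
    set R :=
  [set x | exists j j' : 'I_n, j <> j' /\ x = `|inner (f j) (f j')|].

Definition biangular_frame (R : realType) (n m : nat)
    (f : 'I_n -> 'cV[R]_m) : Prop :=
  is_frame f /\ frame_angle_set f #= `I_2.

Definition inequivalent (R : realType) (n m : nat)
    (f g : 'I_n -> 'cV[R]_m) : Prop :=
  frame_angle_set f <> frame_angle_set g.

Definition transcendental (R : realType) (x : R) : Prop :=
  ~ algebraicOver (ratr : rat -> R) x.

Definition Fmat (R : realType) (t : R) : 'M[R]_(3, 6) :=
  let a := 1 / t ^+ 2 in
  let b := Num.sqrt ((t ^+ 4 - 1) / t ^+ 4) in
  \matrix_(i < 3, j < 6)
    nth 0 (nth [::]
      [:: [:: a; a;   0; 0;   b; - b];
          [:: 0; 0;   b; - b; a; a];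
          [:: b; - b; a; a;   0; 0]] i) j.

(* Main.v *)
Require Import Defs.
From mathcomp Require Import all_boot all_order all_algebra.
From mathcomp Require Import boolp classical_sets cardinality set_interval reals.
From mathcomp Require Import finmap ring lra.
From mathcomp Require Import constructive_ereal measure lebesgue_measure.

Import Order.TTheory GRing.Theory Num.Theory.

Local Open Scope classical_set_scope.
Local Open Scope ring_scope.

(** Put [u = t^-4], so that [a = 1/t^2] and [b = sqrt (1 - u)] satisfy
    [a^2 = u] and [a^2 + b^2 = 1].  The columns of [F(t)] come in three pairs;
    two columns have inner product [a^2 - b^2] inside a pair and [a b] up to
    sign across pairs.  As [(a^2 - b^2)^2 = 1 - 4 (a b)^2], the squared frame
    angles are [p] and [1 - 4 p] with [p = u (1 - u)] ([frame_angle_set_Fmat]).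

    Both depend algebraically on [t], and conversely: [p] determines
    [(u - 1/2)^2], so [u] and [t = u^(-1/4)] are algebraic over [p].  Hence for
    transcendental [t] both squared angles are transcendental
    ([transcendental_sq_angle]); they differ, since [p = 1 - 4 p] would mean
    [p = 1/5], and the frame is biangular.

    If [s] and [t] give the same angle set, then [p s = p t], the other
    matching forcing [p s = 1/5] again.  Restricting [t] to [1 <= t <= 11/10]
    keeps [u] above [1/2], where [u |-> u (1 - u)] is injective, so [s = t].
    Finally there are only countably many algebraic numbers, so uncountably
    many transcendental ones remain in the interval. *)

(** * Algebraic real numbers *)

Section Algebraic.
Variable R : realType.
Implicit Types x : R.

Let alg x := algebraicOver (ratr : rat -> R) x.

(** An infinite root set would contain [size p] distinct roots. *)
Lemma finite_roots (p : {poly R}) : p != 0 -> finite_set [set x | root p x].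
Proof.
move=> p0; apply: contrapT => inf.
have [B Bp szB] := infinite_set_fset (size p) inf.
have : (size (enum_fset B) < size p)%N.
  apply: max_poly_roots => //; last exact: fset_uniq.
  by apply/allP => x xB; exact: Bp.
by rewrite ltnNge szB.
Qed.

(** There are countably many rational polynomials, each with finitely many
    roots. *)
Lemma countable_algebraic : countable [set x | alg x].
Proof.
have -> : [set x | alg x] = \bigcup_(p in [set p : {poly rat} | p != 0])
    [set x | root (map_poly (ratr : rat -> R) p) x].
  by apply/seteqP; split => [x [p p0 px]|x [p p0 px]]; exists p.
apply: bigcup_countable => [|p p0]; first exact: countableP.
by apply: finite_set_countable; apply: finite_roots; rewrite map_poly_eq0.
Qed.

Lemma algebraic_nat n : alg n%:R.
Proof. by rewrite -(ratr_nat R n); exact: algebraic_id. Qed.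

(** If [x ^+ n] is a root of [p], then [x] is a root of [p('X^n)]. *)
Lemma algebraic_root n x : (0 < n)%N -> alg (x ^+ n) -> alg x.
Proof.
move=> n0 [p p0 px]; exists (p \Po 'X^n).
  by rewrite comp_poly_eq0 // size_polyXn.
by rewrite rootE map_comp_poly map_polyXn horner_comp hornerXn.
Qed.

End Algebraic.

(** * The angles of the frames *)

Section Angles.
Variable R : realType.
Implicit Types s t x : R.

(** With [a^2 = t^-4] and [b^2 = 1 - t^-4], this is [(a b)^2], the squared
    inner product of two columns from different pairs. *)
Definition angle_param t : R := t ^- 4 * (1 - t ^- 4).
Local Notation p := angle_param.

Lemma Fmat_entries t : 1 <= t -> exists a b : R,
  [/\ a ^+ 2 + b ^+ 2 = 1, a ^+ 2 = t ^- 4 &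
     Fmat t = \matrix_(i < 3, j < 6) nth 0 (nth [::]
      [:: [:: a; a;   0; 0;   b; - b];
          [:: 0; 0;   b; - b; a; a];
          [:: b; - b; a; a;   0; 0]] i) j].
Proof.
move=> t1; have t0 : t != 0 by rewrite gt_eqF // (lt_le_trans ltr01).
exists (1 / t ^+ 2), (Num.sqrt ((t ^+ 4 - 1) / t ^+ 4)); split => //.
  rewrite sqr_sqrtr; first by field.
  by rewrite divr_ge0 ?subr_ge0 ?exprn_ege1 ?exprn_ge0 ?(le_trans ler01).
by field.
Qed.

Lemma inner3 (v w : 'cV[R]_3) :
  inner v w = v 0 0 * w 0 0 + v 1 0 * w 1 0 + v 2 0 * w 2 0.
Proof.
have e1 : lift ord0 ord0 = 1 :> 'I_3 by apply: val_inj.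
have e2 : lift ord0 (lift ord0 ord0) = 2 :> 'I_3 by apply: val_inj.
by rewrite /inner !big_ord_recl big_ord0 e1 e2 addr0 addrA.
Qed.

Lemma is_frame_Fmat t : 1 <= t -> is_frame (columns (Fmat t)).
Proof.
move=> /Fmat_entries [a [b [ab1 _ ->]]]; split => [j|].
  rewrite /euclidean_norm -[RHS]sqrtr1; congr Num.sqrt; rewrite inner3 !mxE -ab1.
  by case: j => [[|[|[|[|[|[|]]]]]] ?] //=; ring.
(* The frame constant is 2, written so that the entries agree as polynomials
   in [a] and [b]. *)
exists ((a ^+ 2 + b ^+ 2) *+ 2); first by rewrite ab1 ltr0Sn.
rewrite synthesis_columns; apply/matrixP => i k.
rewrite !mxE !big_ord_recl big_ord0 !mxE.
by case: i => [[|[|[|]]] ?] //; case: k => [[|[|[|]]] ?] //=; ring.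
Qed.

Lemma frame_angle_set_Fmat t : 1 <= t ->
  frame_angle_set (columns (Fmat t)) =
    [set Num.sqrt (p t); Num.sqrt (1 - 4 * p t)].
Proof.
move=> /Fmat_entries [a [b [ab1 at4 ->]]].
have b2 : b ^+ 2 = 1 - a ^+ 2 by rewrite -ab1; ring.
have -> : p t = (a * b) ^+ 2 by rewrite exprMn b2 at4.
have -> : 1 - 4 * (a * b) ^+ 2 = (a ^+ 2 - b ^+ 2) ^+ 2.
  by rewrite exprMn b2; ring.
rewrite !sqrtr_sqr; apply/seteqP; split => [x [j [k [jk ->]]]|x].
  rewrite inner3 !mxE.
  (* Each of the 30 ordered pairs has inner product [a b], [- (a b)] or
     [a ^+ 2 - b ^+ 2]. *)
  case: j jk => [[|[|[|[|[|[|]]]]]] ?] //; case: k => [[|[|[|[|[|[|]]]]]] ?] //=;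
  move=> jk; try (by case: jk; apply: val_inj);
  first [ by left; congr `|_|; ring
        | by left; rewrite -normrN; congr `|_|; ring
        | by right; congr `|_|; ring ].
case=> ->.
- exists 0, 2; split=> //; rewrite inner3 !mxE /=; congr `|_|; ring.
- exists 0, 1; split=> //; rewrite inner3 !mxE /=; congr `|_|; ring.
Qed.

(** Completing the square gives [(u - 1/2)^2 = 1/4 - p] with [u = t^-4]; roots
    and inverses of algebraic numbers are algebraic. *)
Lemma transcendental_angle_param t : transcendental t -> transcendental (p t).
Proof.
move=> trt algp; apply: trt; apply: (@algebraic_root _ 4) => //.
rewrite -[t ^+ 4]invrK; apply: algebraic_inv.
rewrite -[t ^- 4](addrNK (2^-1)); apply: algebraic_add; last first.
  exact/algebraic_inv/algebraic_nat.
apply: (@algebraic_root _ 2) => //.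
have -> : (t ^- 4 - 2^-1) ^+ 2 = 4^-1 - p t.
  by rewrite /angle_param; move: (t ^- 4) => u; field.
by apply: algebraic_sub => //; exact/algebraic_inv/algebraic_nat.
Qed.

Lemma transcendental_compl x : transcendental x -> transcendental (1 - 4 * x).
Proof.
move=> trx algx; apply: trx.
have -> : x = (1 - (1 - 4 * x)) / 4 by field.
apply: algebraic_div; last exact: algebraic_nat.
by apply: algebraic_sub => //; exact: algebraic1.
Qed.

(** Otherwise [x] would be the rational number [1/5]. *)
Lemma transcendental_neq_compl x : transcendental x -> x <> 1 - 4 * x.
Proof.
move=> trx xE; apply: trx; have -> : x = 5^-1 by lra.
exact/algebraic_inv/algebraic_nat.
Qed.

Lemma angle_param_ge0 t : 1 <= t -> 0 <= p t.
Proof.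
move=> t1; have t0 : 0 < t by rewrite (lt_le_trans ltr01).
have t4 : 0 < t ^+ 4 by rewrite exprn_gt0.
apply: mulr_ge0; first by rewrite invr_ge0 ltW.
by rewrite subr_ge0 invf_le1 // exprn_ege1.
Qed.

Lemma angle_param_compl_ge0 t : 0 <= 1 - 4 * p t.
Proof.
by have -> : 1 - 4 * p t = (1 - 2 * t ^- 4) ^+ 2;
  [rewrite /angle_param; ring | rewrite sqr_ge0].
Qed.

Lemma transcendental_sq_angle t x : 1 <= t -> transcendental t ->
  frame_angle_set (columns (Fmat t)) x -> transcendental (x ^+ 2).
Proof.
move=> t1 /transcendental_angle_param trp; rewrite frame_angle_set_Fmat //.
case=> ->; rewrite sqr_sqrtr ?angle_param_ge0 ?angle_param_compl_ge0 //.
exact: transcendental_compl.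
Qed.

Lemma card_set2 (T : choiceType) (a b : T) :
  a <> b -> ([set a; b] #= `I_2)%card.
Proof.
move=> /eqP ab; have -> : [set a; b] = [set` [fset a; b]%fset].
  by apply/seteqP; split=> z /= /fset2P.
by apply/card_eq_fsetP; rewrite cardfs2 ab.
Qed.

Lemma biangular_Fmat t : 1 <= t -> transcendental t ->
  biangular_frame (columns (Fmat t)).
Proof.
move=> t1 trt; split; first exact: is_frame_Fmat.
rewrite frame_angle_set_Fmat //; apply: card_set2 => /eqP.
rewrite eqr_sqrt ?angle_param_ge0 ?angle_param_compl_ge0 // => /eqP.
exact/transcendental_neq_compl/transcendental_angle_param.
Qed.

(** The bound [11/10] ensures [t^4 < 2]. *)
Lemma angle_param_inj : {in `[1, 11 / 10] &, injective angle_param}.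
Proof.
have half t : t \in `[1, 11 / 10] -> 0 < t /\ 2^-1 < t ^- 4.
  rewrite in_itv /= => /andP[t1 t2]; have t0 : 0 < t by lra.
  split=> //; rewrite ltf_pV2 ?posrE ?exprn_gt0 //.
  apply: (@le_lt_trans _ _ ((11 / 10) ^+ 4)); last by lra.
  by rewrite lerXn2r ?nnegrE //; lra.
move=> s t /half[s0 us] /half[t0 ut] pst.
have /eqP : (s ^- 4 - t ^- 4) * (1 - (s ^- 4 + t ^- 4)) = 0.
  by rewrite -[RHS](subrr (p t)) -{1}pst /angle_param; ring.
rewrite mulf_eq0 => /orP[|/eqP]; last by lra.
by rewrite subr_eq0 => /eqP/invr_inj/eqP; rewrite eqrXn2 ?ltW // => /eqP.
Qed.

Lemma Fmat_inequivalent s t : s \in `[1, 11 / 10] -> t \in `[1, 11 / 10] ->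
  transcendental s -> s <> t ->
  inequivalent (columns (Fmat s)) (columns (Fmat t)).
Proof.
move=> sI tI trs st eqst.
have s1 : 1 <= s by move: sI; rewrite in_itv => /andP[].
have t1 : 1 <= t by move: tI; rewrite in_itv => /andP[].
have nst : p s <> p t by move=> pst; apply: st; exact: angle_param_inj.
have ge0 := (angle_param_ge0 s s1, angle_param_ge0 t t1, angle_param_compl_ge0).
move: eqst; rewrite !frame_angle_set_Fmat // => eqst.
have ps : p s = 1 - 4 * p t.
  have : [set Num.sqrt (p s); Num.sqrt (1 - 4 * p s)] (Num.sqrt (p s)) by left.
  by rewrite eqst => -[]/eqP; rewrite eqr_sqrt ?ge0 // => /eqP.
have pt : p t = 1 - 4 * p s.
  have : [set Num.sqrt (p t); Num.sqrt (1 - 4 * p t)] (Num.sqrt (p t)) by left.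
  by rewrite -eqst => -[]/eqP; rewrite eqr_sqrt ?ge0 // => /eqP // /esym.
apply: (transcendental_neq_compl (p s)); last by lra.
exact: transcendental_angle_param.
Qed.

End Angles.

(** * Uncountably many parameters *)

(** The interval has positive Lebesgue measure, whereas countable sets are
    null. *)
Lemma uncountable_itv (R : realType) (a b : R) : a < b -> ~ countable `[a, b].
Proof.
move=> ab /countable_lebesgue_measure0.
rewrite lebesgue_measure_itv /= lte_fin ab.
by rewrite -EFinB => -[] /eqP; rewrite subr_eq0 gt_eqF.
Qed.

Theorem mainTheorem5 (R : realType) :
  exists T : set R,
    [/\ T `<=` [set t | 1 <= t],
        ~ countable T,
        forall t : R, T t ->
          biangular_frame (columns (Fmat t)) /\
          (forall x : R, frame_angle_set (columns (Fmat t)) x ->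
             transcendental (x ^+ 2)) &
        forall s t : R, T s -> T t -> s <> t ->
          inequivalent (columns (Fmat s)) (columns (Fmat t))].
Proof.
have ge1 (t : R) : `[1, 11 / 10]%classic t -> 1 <= t.
  by rewrite /= in_itv => /andP[].
exists (`[1, 11 / 10]%classic `&` [set t | transcendental t]); split.
- by move=> t [/ge1].
- move=> ctbl; apply: (@uncountable_itv R 1 (11 / 10)); first by lra.
  have : countable (\bigcup_(c in [set: bool])
      if c then [set x : R | algebraicOver (ratr : rat -> R) x]
      else `[1, 11 / 10]%classic `&` [set t | transcendental t]).
    by apply: bigcup_countable => // -[] _ //; exact: countable_algebraic.
  apply: sub_countable; apply: subset_card_le => t tI.
  have [algt|trt] := pselect (algebraicOver (ratr : rat -> R) t).
    by exists true.
  by exists false.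
- move=> t [/ge1 t1 trt]; split; first exact: biangular_Fmat.
  by move=> x; exact: transcendental_sq_angle.
- by move=> s t [sI trs] [tI _]; exact: Fmat_inequivalent.
Qed.
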